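(* Let $F$ be a fixed non-bipartite graph, and let $f:\mathbb{N}\to\mathbb{R}$ be an arbitrary non-decreasing and log-continuous function. Then, as $n\to\infty$, $$\mathrm{ex}_f(n,F)=(1+o(1))\,\mathrm{ex}_f'(n,F).$$
   Context: $\mathbb{N}$ denotes the set of non-negative integers and $\mathbb{R}$ the set of reals. Graphs are finite and simple; the order of a graph is its number of vertices. A function $f:\mathbb{N}\to\mathbb{R}$ is non-decreasing if $f(m)\le f(n)$ whenever $m\le n$. A non-decreasing function $f:\mathbb{N}\to\mathbb{R}$ is called log-continuous if for any $\varepsilon>0$ there is $\delta>0$ such that for any $m,n\in\mathbb{N}$ with $n\le m\le(1+\delta)n$ we have $f(m)\le(1+\varepsilon)f(n)$. For a function $f:\mathbb{N}\to\mathbb{R}$ and a graph $G$, define $e_f(G)=\sum_{x\in V(G)} f(d(x))$, where $d(x)$ is the degree of the vertex $x$ in $G$. For a graph $F$, a graph is $F$-free if it contains no (not necessarily induced) subgraph isomorphic to $F$. $\mathrm{ex}_f(n,F)$ is the maximum of $e_f(G)$ over all $F$-free graphs $G$ of order $n$. $\mathrm{ex}_f'(n,F)$ is the maximum of $e_f(H)$ over all complete $(\chi(F)-1)$-partite graphs $H$ of order $n$, where $\chi(F)$ is the chromatic number of $F$. A complete $k$-partite graph is a graph whose vertex set is partitioned into $k$ parts (empty parts allowed), with two vertices adjacent if and only if they lie in different parts. The notation $a_n=(1+o(1))\,b_n$ as $n\to\infty$ means that there is a real sequence $\eta_n\to 0$ with $a_n=(1+\eta_n)b_n$ for all sufficiently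 large $n$; here $F$ and $f$ are fixed and $\eta_n$ may depend on them. *)

(* Defs.v *)
From HB Require Import structures.
From mathcomp Require Import all_boot all_order all_algebra.
From mathcomp Require Import reals.
Import Order.TTheory GRing.Theory Num.Theory.

Set Implicit Arguments.
Unset Strict Implicit.
Unset Printing Implicit Defensive.

Local Open Scope ring_scope.

Definition simple_rel (V : finType) (e : {ffun V * V -> bool}) : bool :=
  [forall x, ~~ e (x, x)] && [forall x, forall y, e (x, y) == e (y, x)].

(* The edge relation is a finite function so that, for each V, the graphs with
   vertex set V form a finType over which maxima can be taken. *)
Record sgraph (V : finType) := SGraph {
  edge_fun : {ffun V * V -> bool};
  edge_funP : simple_rel edge_fun }.

HB.instance Definition _ (V : finType) := [isSub for @edge_fun V].
HB.instance Definition _ (V : finType) := [Finite of sgraph V by <:].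

Definition adj (V : finType) (G : sgraph V) : rel V :=
  fun x y => edge_fun G (x, y).

Definition deg (V : finType) (G : sgraph V) (x : V) : nat :=
  #|[set y | adj G x y]|.

Lemma edgeless_subproof (V : finType) : simple_rel [ffun _ : V * V => false].
Proof.
apply/andP; split; first by apply/forallP => x; rewrite ffunE.
by apply/forallP => x; apply/forallP => y; rewrite !ffunE.
Qed.

Definition edgeless (V : finType) : sgraph V := SGraph (edgeless_subproof V).

Definition contains_copy (V W : finType) (G : sgraph V) (F : sgraph W) : bool :=
  [exists h : {ffun W -> V}, injectiveb h &&
    [forall x, forall y, adj F x y ==> adj G (h x) (h y)]].

Definition is_free (V W : finType) (F : sgraph W) (G : sgraph V) : bool :=
  ~~ contains_copy G F.

Definition bipartite (V : finType) (G : sgraph V) : bool :=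
  [exists A : {set V}, forall x, forall y,
    adj G x y ==> ((x \in A) != (y \in A))].

Definition colorable (V : finType) (G : sgraph V) (k : nat) : bool :=
  [exists c : {ffun V -> 'I_k}, forall x, forall y,
    adj G x y ==> (c x != c y)].

Lemma colorable_exists (V : finType) (G : sgraph V) : exists k, colorable G k.
Proof.
exists #|V|; apply/existsP; exists [ffun x => enum_rank x].
apply/forallP => x; apply/forallP => y; apply/implyP => Gxy; rewrite !ffunE.
rewrite (inj_eq enum_rank_inj); apply: contraTneq Gxy => ->.
by have /andP[/forallP/(_ y)] := edge_funP G.
Qed.

Definition chromatic_number (V : finType) (G : sgraph V) : nat :=
  ex_minn (colorable_exists G).

(* The part of x is c x; c need not be surjective, so parts may be empty. *)
Definition complete_multipartite (k : nat) (V : finType) (G : sgraph V) : bool :=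
  [exists c : {ffun V -> 'I_k}, forall x, forall y,
    adj G x y == (c x != c y)].

Section Maxima.
Variable R : realType.
Implicit Type f : nat -> R.

Definition log_continuous f : Prop :=
  forall eps : R, 0 < eps -> exists delta : R, 0 < delta /\
    forall m n : nat, (n <= m)%N -> m%:R <= (1 + delta) * n%:R ->
      f m <= (1 + eps) * f n.

Definition ef f (V : finType) (G : sgraph V) : R := \sum_(x : V) f (deg G x).

(* The maximum is genuine only if the edgeless graph satisfies P (ef_maxP);
   for the two instances below, this holds as soon as F is not bipartite
   (edgeless_free and edgeless_multipartite). *)
Definition ef_max f (n : nat) (P : pred (sgraph 'I_n)) : R :=
  ef f [arg max_(G > edgeless 'I_n | P G) ef f G]%O.

Definition ex_f f (n : nat) (W : finType) (F : sgraph W) : R :=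
  ef_max f (fun G : sgraph 'I_n => is_free F G).

Definition ex_f' f (n : nat) (W : finType) (F : sgraph W) : R :=
  ef_max f (fun H : sgraph 'I_n =>
    complete_multipartite (chromatic_number F).-1 H).

Lemma ef_maxP f n (P : pred (sgraph 'I_n)) : P (edgeless 'I_n) ->
  (exists2 G, P G & ef_max f P = ef f G) /\
  (forall G, P G -> ef f G <= ef_max f P).
Proof.
by move=> P0; rewrite /ef_max; case: arg_maxP => // G PG Gmax; split=> //; exists G.
Qed.

End Maxima.

Lemma edgeless_free (V W : finType) (F : sgraph W) :
  ~~ bipartite F -> is_free F (edgeless V).
Proof.
apply: contraNN => /existsP[h /andP[_ /forallP hP]].
apply/existsP; exists set0; apply/forallP => x; apply/forallP => y.
by have /forallP/(_ y) := hP x; rewrite {2}/adj /= ffunE implybF => /negbTE->.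
Qed.

Lemma edgeless_multipartite (V W : finType) (F : sgraph W) :
  ~~ bipartite F ->
  complete_multipartite (chromatic_number F).-1 (edgeless V).
Proof.
move=> nbF; have: (1 < chromatic_number F)%N.
  rewrite /chromatic_number; case: ex_minnP => k /existsP[c /forallP cP] _.
  rewrite ltnNge; apply: contraNN nbF => k1.
  apply/existsP; exists set0; apply/forallP => x; apply/forallP => y.
  have /forallP/(_ y) := cP x; suff -> : c x = c y by rewrite eqxx implybF => /negbTE->.
  apply/val_inj; move: (ltn_ord (c x)) (ltn_ord (c y)).
  by case: k k1 c {cP} => [|[|//]] _ c /=; do 2?[case: (nat_of_ord _) => //].
case: (chromatic_number F) => [|[|k]] // _.
apply/existsP; exists [ffun=> ord0]; apply/forallP => x; apply/forallP => y.
by rewrite /adj /= !ffunE eqxx.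
Qed.

(* Main.v *)
Require Import Defs.
From mathcomp Require Import all_boot all_order all_algebra.
From mathcomp Require Import all_classical all_reals all_analysis.
From mathcomp Require Import ring lra.
Import Order.TTheory GRing.Theory Num.Theory.
Import numFieldNormedType.Exports.

(** The lower bound ex_f >= ex_f' holds because a complete (chi(F)-1)-partite
graph is (chi(F)-1)-colourable and so contains no copy of F.

The upper bound is by sampling. Write r = chi(F)-1 and let G be F-free of
large order n.

Since F embeds in a blow-up of K_{r+1}, a positive density of (r+1)-cliques
would force a copy of F (Erdos's theorem on dense multipartite hypergraphs,
[dense_contains_box]); hence G has only o(n^(r+1)) cliques of order r+1
([few_cliques]). Draw s vertices x_1, ..., x_s of G at random, independently,
with s a large constant. With probability close to 1 the graph induced on the
sample has no K_{r+1} ([sampled_cliques]), and by Chebyshev's inequality all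
but a small proportion of the sampled vertices have at least their expected
degree in the sample, up to gam * s ([sample_degree_deviates]).

A K_{r+1}-free graph is degree-dominated by a complete r-partite graph on the
same vertices ([clique_free_dominated], also due to Erdos). Applied to the
sample and blown up to order n, this gives a complete r-partite graph of
order n whose degrees are nearly as large as the degrees in G of the
corresponding sampled vertices; log-continuity turns this into a comparison
of the values of f ([sampled_sum_le]). So the mean of f(d(x_i)) over the
sample is at most (1 + o(1)) ex_f' / n, and averaging over all samples gives
e_f(G) <= (1 + o(1)) ex_f' ([ef_le_of_few_cliques]).

All additive errors are small multiples of n * f(n). They are absorbed because
log-continuity bounds f(2m+1) by a constant times f(m), while a balanced
bipartite graph shows ex_f' to be at least about n * f(n/2)
([top_degree_le_ex_f']). *)

Local Open Scope ring_scope.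
Set Implicit Arguments.
Unset Strict Implicit.
Unset Printing Implicit Defensive.

(** * Dense sets of words contain boxes *)

Lemma nat_above (R : realType) (a : R) : exists N : nat, a <= N%:R.
Proof. by exists (Num.truncn a).+1; apply/ltW/truncnS_gt. Qed.

Lemma sum_tuple_cons (R : realType) (V : finType) k (g : seq V -> R) :
  \sum_(u : k.+1.-tuple V) g u = \sum_v \sum_(u : k.-tuple V) g (v :: u).
Proof.
rewrite pair_big /= (reindex (fun p : V * k.-tuple V => [tuple of p.1 :: p.2])) //=.
exists (fun u => (thead u, [tuple of behead u])) => [[v u] _|u _].
  by rewrite theadE /=; congr pair; apply/val_inj.
by rewrite /= [RHS]tuple_eta.
Qed.

Lemma sum1_tuple (R : realType) (V : finType) k (a : R) :
  \sum_(u : k.-tuple V) a = #|V|%:R ^+ k * a.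
Proof. by rewrite sumr_const card_tuple -[LHS]mulr_natl natrX. Qed.

Lemma natr_card (R : realType) (T : finType) (P : pred T) :
  #|[set x | P x]|%:R = \sum_x (P x)%:R :> R.
Proof.
rewrite -sum1dep_card natr_sum [LHS]big_mkcond /=.
by apply: eq_bigr => x _; case: (P x).
Qed.

(** Injections are nearly as numerous as maps, once the target is large. *)
Lemma pow_le_ffact (R : realType) (a N : nat) (b : R) : 0 <= b ->
  2 * b <= N%:R -> 2 * a%:R <= N%:R :> R -> b ^+ a <= (N ^_ a)%:R.
Proof.
move=> b0 bN aN.
have h t : (t <= a)%N -> b ^+ t <= (N ^_ t)%:R :> R.
  elim: t => [|t IH] ta; first by rewrite expr0 ffactn0.
  rewrite ffactnSr exprSr natrM.
  have tN : (t <= N)%N.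
    rewrite -(ler_nat R); have : t%:R <= a%:R :> R by rewrite ler_nat ltnW.
    by have := ler0n R a; lra.
  apply: ler_pM => //; [exact: exprn_ge0|exact: IH (ltnW ta)|].
  rewrite natrB //; have : t%:R <= a%:R :> R by rewrite ler_nat ltnW.
  lra.
exact: h.
Qed.

Lemma exists_ge_avg (R : realType) (I : finType) (P : pred I) (g : I -> R) (a m : R) :
  0 < a -> 0 < m -> #|P|%:R <= m -> m * a <= \sum_(i | P i) g i ->
  exists2 i, P i & a <= g i.
Proof.
move=> a0 m0 Pm H.
case: (pselect (exists2 i, P i & a <= g i)) => // /forall2NP nP; exfalso.
have lt i : P i -> g i < a by move=> Pi; have [//|/negP] := nP i; rewrite -ltNge.
have : \sum_(i | P i) g i < m * a; last by rewrite ltNge H.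
apply: (@lt_le_trans _ _ (\sum_(i | P i) a)); last first.
  rewrite sumr_const -[leLHS]mulr_natl; by rewrite ler_pM2r.
case: (pickP P) => [i0 Pi0|P0]; last by move: H; rewrite big_pred0 // leNgt mulr_gt0.
by apply: ltr_sum => //; apply/hasP; exists i0 => //; rewrite mem_index_enum.
Qed.

(** Erdos's theorem on dense multipartite hypergraphs, for words of length [k].
Choose the first side [f : T -> V] injective so that the words [y] extending
every [f t] are still dense, and recurse on those. Such an [f] exists on
average: a suffix [y] with [N] good first letters is good for [N ^_ #|T|]
injections. *)
Lemma dense_contains_box (R : realType) (T : finType) k (eps : R) : 0 < eps ->
  exists N, forall (V : finType) (P : pred (seq V)), (N <= #|V|)%N ->
    eps * #|V|%:R ^+ k <= \sum_(u : k.-tuple V) (P u)%:R ->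
    exists2 b : nat -> T -> V, (forall i, (i < k)%N -> injective (b i)) &
      forall tau : nat -> T, P (mkseq (fun i => b i (tau i)) k).
Proof.
elim: k eps => [|k IH] eps e0.
  exists 1%N => V P V1; rewrite expr0 mulr1.
  have [v _] : exists v, v \in V by apply/card_gt0P.
  rewrite (eq_bigr (fun=> (P [::])%:R)); last by move=> u _; rewrite tuple0.
  rewrite sum1_tuple expr0 mul1r; case PP: (P [::]) => /= H; last by move: e0; rewrite ltNge H.
  by exists (fun _ _ => v).
set a := #|T|.
set e' := (eps / 4) ^+ a * (eps / 2).
have e'0 : 0 < e' by rewrite mulr_gt0 ?exprn_gt0 //; lra.
have [N HN] := IH _ e'0.
have [M HM] := nat_above (4 * a%:R / eps).
exists (maxn (maxn N M) 1) => V P; rewrite !geq_max => /andP[/andP[NV MV] V1].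
set n := #|V| in NV MV V1 *.
have n0 : 0 < n%:R :> R by rewrite ltr0n.
have an : 4 * a%:R <= n%:R * eps.
  by rewrite -ler_pdivrMr // (le_trans HM) // ler_nat.
rewrite (sum_tuple_cons k (fun u : seq V => (P u)%:R : R)) exchange_big /= => HP.
pose Nb (y : seq V) := [set v | P (v :: y)]%SET.
have NbE y : \sum_v (P (v :: y))%:R = #|Nb y|%:R :> R by rewrite natr_card.
pose Q (f : {ffun T -> V}) (y : seq V) := [forall t, P (f t :: y)].
have key : n%:R ^+ a * (e' * n%:R ^+ k) <=
    \sum_(f : {ffun T -> V} | injectiveb f) \sum_(y : k.-tuple V) (Q f y)%:R.
  rewrite exchange_big /=.
  have -> : \sum_(j : k.-tuple V) \sum_(i : {ffun T -> V} | injectiveb i) (Q i j)%:R =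
      \sum_(y : k.-tuple V) (#|Nb y| ^_ a)%:R :> R.
    apply: eq_bigr => y _; rewrite -card_inj_ffuns_on -natr_sum; congr (_%:R).
    rewrite -sum1dep_card big_mkcond [RHS]big_mkcond /=.
    apply: eq_bigr => f _; rewrite inE andbC.
    have -> : [forall x, f x \in Nb y] = Q f y.
      by apply/forallP/forallP => H t; have := H t; rewrite inE.
    by case: injectiveb => //; case: (Q f y).
  (* The affine factor N / n - eps / 2 stands in for the indicator of
     N >= eps n / 2: it is at most 1, negative below the threshold, and its mean
     is at least eps / 2. *)
  apply: (@le_trans _ _ (\sum_(y : k.-tuple V) (n%:R * (eps / 4)) ^+ a
      * (#|Nb y|%:R / n%:R - eps / 2))).
    rewrite -mulr_sumr big_split /= sum1_tuple -mulr_suml.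
    have -> : (n%:R * (eps / 4)) ^+ a = n%:R ^+ a * (eps / 4) ^+ a by rewrite exprMn.
    rewrite /e' -![in leLHS]mulrA -mulrA ler_pM2l ?exprn_gt0 // ler_pM2l; last first.
      by rewrite exprn_gt0 //; lra.
    have := HP; rewrite (eq_bigr _ (fun y _ => NbE (tval y))) exprS => H.
    have : eps * n%:R ^+ k <= (\sum_(i : k.-tuple V) #|Nb i|%:R) / n%:R.
      by rewrite ler_pdivlMr // -mulrA [_ * n%:R]mulrC.
    rewrite -/n; lra.
  apply: ler_sum => y _.
  have NbV : #|Nb y|%:R / n%:R <= 1 :> R by rewrite ler_pdivrMr // mul1r ler_nat max_card.
  have p0 : 0 <= (n%:R * (eps / 4)) ^+ a :> R by rewrite exprn_ge0 // mulr_ge0 //; lra.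
  case: (lerP (eps / 2) (#|Nb y|%:R / n%:R)) => Hy; last first.
    apply: (@le_trans _ _ 0); last by [].
    by rewrite mulr_ge0_le0 // subr_le0 ltW.
  apply: (@le_trans _ _ ((n%:R * (eps / 4)) ^+ a)).
    by rewrite ler_piMr //; lra.
  move: Hy; rewrite ler_pdivlMr // => Hy.
  apply: pow_le_ffact => //; first by rewrite mulr_ge0 //; lra.
    by lra.
  by lra.
have [|||f finj Hf] := exists_ge_avg _ _ _ key.
- by rewrite mulr_gt0 ?exprn_gt0.
- by rewrite exprn_gt0.
- by rewrite -natrX ler_nat -card_ffun max_card.
have [b binj bP] := HN V (Q f) NV Hf.
exists (fun i => if i is j.+1 then b j else (fun t => f t)) => [[_|i]|tau].
- exact/injectiveP.
- by rewrite ltnS; apply: binj.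
have := bP (fun i => tau i.+1); move/forallP/(_ (tau 0%N)).
rewrite /mkseq /= (iotaDl 1 0 k) -map_comp.
by congr P; congr cons; apply: eq_map.
Qed.

(** * Degree domination in clique-free graphs *)

(** Induct on [r]: let [v] have maximum degree in [A] and [N] be its
neighbourhood. [N] has no clique of size [r], so it is dominated by a
colouring with [r - 1] colours; give [A :\: N] the last colour. Vertices of
[N] gain all of [A :\: N] as neighbours, and the others get degree [#|N|],
the maximum. *)
Lemma clique_free_dominated (T : finType) (e : rel T) (r : nat) (A : {set T}) :
  symmetric e ->
  (forall u : seq T, size u = r.+1 -> {subset u <= A} -> ~~ pairwise e u) ->
  exists c : T -> nat, {in A, forall x, (c x < r)%N /\
    (#|[set y in A | e x y]| <= #|[set y in A | c y != c x]|)%N}.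
Proof.
move=> esym; elim: r A => [|r IH] A Afree.
  exists (fun=> 0%N) => x xA; exfalso.
  have := Afree [:: x] erefl; rewrite /= => /(_ _)/negP.
  by apply=> // y; rewrite inE => /eqP->.
case: (set_0Vmem A) => [->|[v0 v0A]].
  by exists (fun=> 0%N) => x; rewrite inE.
pose d x := #|[set y in A | e x y]|.
have [v vA vmax] : exists2 v, v \in A & forall x, x \in A -> (d x <= d v)%N.
  by case: (arg_maxnP d v0A) => v vA vmax; exists v.
pose N := [set y in A | e v y].
have [|c cP] := IH N.
  move=> u su uN; apply/negP => pu.
  have := Afree (v :: u); rewrite /= su => /(_ erefl)/(_ _)/negP; apply.
    by move=> y; rewrite inE => /orP[/eqP->//|/uN]; rewrite inE => /andP[].
  by rewrite pu andbT; apply/allP => y /uN; rewrite inE => /andP[].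
exists (fun x => if x \in N then c x else r) => x xA.
case: ifP => xN.
  have [cx dx] := cP _ xN; split; first exact: ltnW.
  have split2 (P : pred T) : #|[set y in A | P y]| =
      (#|[set y in N | P y]| + #|[set y in A :\: N | P y]|)%N.
    rewrite -(cardsID N); congr (_ + _)%N; apply: eq_card => y; rewrite !inE;
    by case: (y \in A); case: (e v y); rewrite ?andbF ?andbT.
  rewrite (split2 (e x)) (split2 [pred y | (if y \in N then c y else r) != c x]).
  apply: leq_add.
    apply: (leq_trans dx); apply/subset_leq_card/fintype.subsetP => y; rewrite !inE.
    by case/andP=> /andP[-> ->] /=.
  apply/subset_leq_card/fintype.subsetP => y; rewrite !inE => /andP[/andP[yN yA] _].
  by move: yN; rewrite yA /= => /negPf->; rewrite gtn_eqF.
split=> //; apply: (leq_trans (vmax x xA)).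
apply/subset_leq_card/fintype.subsetP => y yN; have [cy _] := cP _ yN.
by rewrite inE yN ltn_eqF // andbT; move: yN; rewrite inE => /andP[].
Qed.

(** * Uniform samples of vertices *)

Definition resample (I V : finType) (x : {ffun I -> V}) (i : I) (v : V) : {ffun I -> V} :=
  [ffun j => if j == i then v else x j].

(** The map exchanging the coordinate [x i] with the fresh vertex [v] is an
involution, so redrawing one coordinate of a uniform sample leaves it
uniform. All the probabilistic estimates rest on this. *)
Lemma sum_resample (R : realType) (I V : finType) (i : I) (g : {ffun I -> V} -> R) :
  \sum_x \sum_v g (resample x i v) = #|V|%:R * \sum_x g x.
Proof.
pose sw (p : {ffun I -> V} * V) := (resample p.1 i p.2, p.1 i).
have swK : cancel sw sw.
  move=> [x v]; rewrite /sw /= ffunE eqxx; congr pair.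
  by apply/ffunP => j; rewrite !ffunE; case: eqP => [->|].
rewrite pair_big /= (reindex_inj (can_inj swK)) /=.
rewrite (eq_bigr (fun p => g p.1)); last first.
  by move=> p _; congr g; have := swK p => /(congr1 fst).
by rewrite -(pair_big predT predT (fun x _ => g x)) /= mulr_sumr;
  apply: eq_bigr => x _; rewrite sumr_const mulr_natl.
Qed.

(** The coordinates of a sample at distinct places form a uniform word. *)
Lemma sum_sample_seq (R : realType) (I V : finType) (places : seq I) (g : seq V -> R) :
  uniq places ->
  #|V|%:R ^+ size places * \sum_(x : {ffun I -> V}) g [seq x i | i <- places] =
  #|V|%:R ^+ #|I| * \sum_(u : (size places).-tuple V) g u.
Proof.
elim: places g => [|i l IH] g /=.
  move=> _; rewrite expr0 mul1r (eq_bigr (fun=> g [::])) // sumr_const card_ffun.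
  rewrite (eq_bigr (fun=> g [::])) => [|u _]; last by rewrite tuple0.
  by rewrite sumr_const card_tuple expn0 mulr1n -[LHS]mulr_natl natrX.
case/andP => il ul.
rewrite exprSr -mulrA -(sum_resample i) /= exchange_big /=.
rewrite sum_tuple_cons [RHS]mulr_sumr [LHS]mulr_sumr; apply: eq_bigr => v _.
rewrite -(IH (fun u => g (v :: u))) //; congr (_ * _); apply: eq_bigr => x _.
rewrite ffunE eqxx; congr (g (_ :: _)); apply/eq_in_map => j jl.
by rewrite ffunE; case: eqP => // ji; move: il; rewrite -ji jl.
Qed.

Lemma sum_sample1 (R : realType) (I V : finType) (i : I) (g : V -> R) :
  #|V|%:R * \sum_(x : {ffun I -> V}) g (x i) = #|V|%:R ^+ #|I| * \sum_v g v.
Proof.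
rewrite -(sum_resample i) (eq_bigr (fun=> \sum_v g v)) => [|x _].
  by rewrite sumr_const card_ffun -[LHS]mulr_natl natrX.
by apply: eq_bigr => v _; rewrite ffunE eqxx.
Qed.

Section Chebyshev.
Variables (R : realType) (I V : finType) (e : rel V).
Local Notation n := (#|V|%:R : R).
Local Notation s := (#|I|%:R : R).
Local Notation degr v := (\sum_w (e v w)%:R : R).

Let dev (x : {ffun I -> V}) i j : R := (e (x i) (x j))%:R - degr (x i) / n.

Let dev_bound (V0 : (0 < #|V|)%N) x i j : `|dev x i j| <= 1.
Proof.
have d0 : 0 <= degr (x i) by apply: sumr_ge0.
have d1 : degr (x i) <= n.
  rewrite -sum1_card natr_sum; apply: ler_sum => w _; by case: e.
have q0 : 0 <= degr (x i) / n by rewrite divr_ge0.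
have q1 : degr (x i) / n <= 1 by rewrite ler_pdivrMr ?ltr0n // mul1r.
by rewrite /dev ler_norml; case: e => /=; apply/andP; split; lra.
Qed.

Let dev_orth (V0 : (0 < #|V|)%N) i j k : k != i -> k != j ->
  \sum_x dev x i j * dev x i k = 0.
Proof.
move=> ki kj; have n0 : n != 0 by rewrite pnatr_eq0 -lt0n.
apply: (mulfI n0); rewrite mulr0 -(sum_resample k) big1 // => x _.
rewrite (eq_bigr (fun v => dev x i j * ((e (x i) v)%:R - degr (x i) / n))) => [|v _].
  rewrite -mulr_sumr big_split /= sumr_const -[X in _ + X]mulr_natl mulrN mulrCA.
  by rewrite mulfV // mulr1 subrr mulr0.
by rewrite /dev !ffunE eqxx ![_ == k]eq_sym (negPf ki) (negPf kj).
Qed.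

(** The deviations [dev x i j] and [dev x i k] are orthogonal for [j != k]: one
of [j] and [k] differs from [i], and averaging over that coordinate of [x]
alone gives 0. So only the [#|I|] diagonal terms contribute. *)
Lemma sample_variance (V0 : (0 < #|V|)%N) (i : I) :
  \sum_(x : {ffun I -> V})
     ((\sum_j (e (x i) (x j))%:R) - s * (degr (x i) / n)) ^+ 2 <= s * n ^+ #|I|.
Proof.
have -> : \sum_(x : {ffun I -> V})
     ((\sum_j (e (x i) (x j))%:R) - s * (degr (x i) / n)) ^+ 2 =
   \sum_(x : {ffun I -> V}) \sum_j \sum_k dev x i j * dev x i k.
  apply: eq_bigr => x _.
  have -> : (\sum_j (e (x i) (x j))%:R) - s * (degr (x i) / n) = \sum_j dev x i j.
    by rewrite big_split /= sumr_const -[X in _ = _ + X]mulr_natl mulrN.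
  by rewrite expr2 mulr_suml; apply: eq_bigr => j _; rewrite mulr_sumr.
rewrite exchange_big /= mulr_natl -sumr_const; apply: ler_sum => j _.
rewrite exchange_big /= (bigD1 j) //= [X in _ + X]big1 ?addr0 => [|k kj].
  apply: (@le_trans _ _ (\sum_(x : {ffun I -> V}) 1)); last first.
    by rewrite sumr_const card_ffun natrX.
  apply: ler_sum => x _; rewrite -expr2 -real_normK ?num_real // expr_le1 //.
  exact: dev_bound.
have [ki|ki] := eqVneq k i; last exact: dev_orth.
under eq_bigr => x _ do rewrite mulrC.
by apply: dev_orth => //; rewrite ?[j == _]eq_sym // -ki.
Qed.

Lemma sample_degree_deviates (V0 : (0 < #|V|)%N) (I0 : (0 < #|I|)%N) (i : I) (gam : R) :
  0 < gam ->
  \sum_(x : {ffun I -> V})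
     (\sum_j (e (x i) (x j))%:R + gam * s < s * (degr (x i) / n))%R%:R
   <= n ^+ #|I| / (gam ^+ 2 * s).
Proof.
move=> g0; have s0 : 0 < s by rewrite ltr0n.
rewrite ler_pdivlMr ?mulr_gt0 ?exprn_gt0 // -(ler_pM2r s0).
rewrite [leRHS]mulrC; apply: le_trans (sample_variance V0 i).
rewrite -mulrA mulr_suml; apply: ler_sum => x _.
case: ltP => h /=; last by rewrite mul0r sqr_ge0.
have gs : 0 <= gam * s by rewrite mulr_ge0 ?ltW.
by rewrite mul1r -mulrA -expr2 -exprMn -[leRHS]sqrrN ler_sqr ?nnegrE ?gs //; lra.
Qed.
End Chebyshev.

(** * Cliques in F-free graphs and in their samples *)

Lemma adj_sym (V : finType) (G : sgraph V) : symmetric (adj G).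
Proof. by move=> x y; have /andP[_ /forallP/(_ x)/forallP/(_ y)/eqP] := edge_funP G. Qed.

Lemma adj_irr (V : finType) (G : sgraph V) : irreflexive (adj G).
Proof. by move=> x; have /andP[/forallP/(_ x)/negPf] := edge_funP G. Qed.

(** A box in the set of [k]-cliques gives, for each colour [i], an injection
[b i] of the vertices of [F] into [G], with all edges between different
colours present. Then [w |-> b (c w) w] embeds [F], for a [k]-colouring [c]
of [F]. *)
Lemma few_cliques (R : realType) (W : finType) (F : sgraph W) k (mu : R) :
  colorable F k -> 0 < mu ->
  exists N, forall (V : finType) (G : sgraph V), (N <= #|V|)%N -> is_free F G ->
    \sum_(u : k.-tuple V) (pairwise (adj G) u)%:R <= mu * #|V|%:R ^+ k.
Proof.
move=> /existsP[c cP] mu0; have [N HN] := dense_contains_box W k mu0.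
exists N => V G NV; apply: contraNle => /ltW dense; apply/existsP.
have [b binj bP] := HN V (fun u => pairwise (adj G) u) NV dense.
have cross w w' : c w != c w' -> adj G (b (c w) w) (b (c w') w').
  wlog lt : w w' / (c w < c w')%N.
    move=> H nec; have := nec; rewrite -val_eqE neq_ltn => /orP[lt|lt]; first exact: H.
    by rewrite adj_sym; apply: H; rewrite // eq_sym.
  move=> _; have := bP (fun i => if i == c w then w else w').
  move/(pairwiseP (b (c w) w))/(_ (c w) (c w')).
  rewrite !inE size_mkseq !ltn_ord => /(_ isT isT lt).
  by rewrite !nth_mkseq ?ltn_ord // eqxx (gtn_eqF lt).
exists [ffun w => b (c w) w]; apply/andP; split.
  apply/injectiveP => w w'; rewrite !ffunE => eqb.
  have [eqc|nec] := eqVneq (c w) (c w'); last by have := cross _ _ nec; rewrite eqb adj_irr.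
  by move: eqb; rewrite eqc; apply: binj.
apply/forallP => w; apply/forallP => w'; apply/implyP => Fww'; rewrite !ffunE.
by apply: cross; have /forallP/(_ w)/forallP/(_ w')/implyP := cP; apply.
Qed.

(** Union bound over the places of the sample. Repeated vertices in a sample
cannot make a clique, since [adj G] is irreflexive. *)
Lemma sampled_cliques (R : realType) (I V : finType) (G : sgraph V) k (mu : R) :
  (0 < #|V|)%N ->
  \sum_(u : k.-tuple V) (pairwise (adj G) u)%:R <= mu * #|V|%:R ^+ k ->
  \sum_(x : {ffun I -> V}) [exists u : k.-tuple I, pairwise (relpre x (adj G)) u]%:R
    <= #|I|%:R ^+ k * mu * #|V|%:R ^+ #|I|.
Proof.
move=> V0 few; have n0 : 0 < #|V|%:R :> R by rewrite ltr0n.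
have mu0 : 0 <= mu.
  by rewrite -(pmulr_lge0 _ (exprn_gt0 k n0)) (le_trans _ few) // sumr_ge0.
apply: (@le_trans _ _ (\sum_(x : {ffun I -> V}) \sum_(u : k.-tuple I)
    (uniq u && pairwise (adj G) [seq x i | i <- u])%:R)).
  apply: ler_sum => x _; case: existsP => [[u pu]|_] /=; last by apply: sumr_ge0.
  rewrite (bigD1 u) //= -[leLHS]addr0 lerD ?sumr_ge0 //.
  rewrite pairwise_map pu andbT ler_nat lt0b uniq_pairwise.
  by apply: sub_pairwise pu => i j; apply: contraTneq => ->; rewrite /= adj_irr.
rewrite exchange_big /= -mulrA -sum1_tuple; apply: ler_sum => u _.
have [uu|_] := boolP (uniq u); last by rewrite big1 // mulr_ge0 // exprn_ge0.
rewrite -(ler_pM2l (exprn_gt0 k n0)) /=.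
have := sum_sample_seq (V := V) (fun v => (pairwise (adj G) v)%:R : R) uu.
rewrite size_tuple => ->.
by rewrite mulrA [leRHS]mulrC ler_pM2l ?exprn_gt0 // [leRHS]mulrC.
Qed.

(** * Blow-ups and lower bounds for ex_f' *)

Lemma card_residue n s (i : 'I_s) (s0 : (0 < s)%N) :
  (n %/ s <= #|[set m : 'I_n | m %% s == i]|)%N.
Proof.
have lt (j : 'I_(n %/ s)) : (j * s + i < n)%N.
  apply: (@leq_trans (j.+1 * s)); first by rewrite mulSn addnC ltn_add2r.
  by rewrite (leq_trans _ (leq_divM n s)) // leq_pmul2r.
rewrite -[leqLHS]card_ord -(card_imset predT (f := fun j => Ordinal (lt j))) => [|j j'].
  apply/subset_leq_card/fintype.subsetP => m /imsetP[j _ ->].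
  by rewrite inE /= modnMDl modn_small.
by move/(congr1 val) => /= /eqP; rewrite eqn_add2r eqn_pmul2r // => /eqP/val_inj.
Qed.

Lemma multipartite_subproof (V : finType) (c : V -> nat) :
  simple_rel [ffun p : V * V => c p.1 != c p.2].
Proof.
apply/andP; split; first by apply/forallP => x; rewrite ffunE /= eqxx.
by apply/forallP => x; apply/forallP => y; rewrite !ffunE /= [c x == _]eq_sym.
Qed.

Definition multipartite (V : finType) (c : V -> nat) : sgraph V :=
  SGraph (multipartite_subproof c).

(** If blowing [s] points up [q] times puts the total [q * S] below [M], and the
blow-up misses few of the [n] vertices, then the mean [S / s] is nearly below
[M / n]. *)
Lemma mean_le_of_blowup (R : realType) (s q n e1 S M : R) : 0 < n -> 0 <= S -> 0 <= s ->
  q * S <= M -> n <= (1 + e1) * q * s -> 0 <= e1 -> S <= s / n * ((1 + e1) * M).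
Proof.
move=> n0 S0 s0 qS nq e10; rewrite mulrAC ler_pdivlMr //.
apply: (@le_trans _ _ (S * ((1 + e1) * q * s))); first exact: ler_wpM2l.
have : 0 <= s * (1 + e1) by rewrite mulr_ge0 //; lra.
by move=> /ler_wpM2l/(_ _ _ qS); lra.
Qed.

Lemma divn_ratio (R : realType) n s (e1 : R) : (0 < s)%N -> 1 <= e1 * (n %/ s)%:R ->
  n%:R <= (1 + e1) * (n %/ s)%:R * s%:R.
Proof.
move=> s0 H; apply: (@le_trans _ _ (((n %/ s).+1)%:R * s%:R)).
  by rewrite -natrM ler_nat ltnW // ltn_ceil.
by rewrite ler_wpM2r // -natr1; lra.
Qed.

Lemma collect_errors (R : realType) (eps C kap e1 M a : R) :
  0 < eps -> 0 < C -> 0 < kap -> 0 < e1 -> 0 <= M ->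
  e1 <= 1 -> e1 <= eps / 8 -> kap <= eps / (6 * C) -> a <= C * M ->
  (1 + e1) ^+ 2 * M + 3 * kap * a <= (1 + eps) * M.
Proof.
move=> eps0 C0 k0 e10 M0 e11 e18 kC aM.
have h1 : kap * a <= kap * (C * M) by rewrite ler_pM2l.
have h2 : kap * (C * M) <= eps / 6 * M.
  by rewrite mulrA ler_wpM2r // -ler_pdivlMr // -mulrA -invfM.
have h3 : (1 + e1) ^+ 2 * M <= (1 + 3 * (eps / 8)) * M.
  by rewrite ler_wpM2r // expr2; have : e1 * e1 <= e1 * 1; [rewrite ler_pM2l | lra].
have h4 : 0 <= eps * M by rewrite mulr_ge0 // ltW.
lra.
Qed.

Section Degrees.
Variables (R : realType) (W : finType) (F : sgraph W) (f : nat -> R).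
Hypotheses (nonbipF : ~~ bipartite F)
  (f_nondecreasing : {homo f : m n / (m <= n)%N >-> m <= n})
  (f_logcont : log_continuous f).
Local Notation r := (chromatic_number F).-1.

(** Taking [m = n] in log-continuity gives [f n <= 2 * f n]. *)
Lemma log_continuous_ge0 n : 0 <= f n.
Proof.
have [d [d0 H]] := f_logcont ltr01.
have /(H n n (leqnn n)) : n%:R <= (1 + d) * n%:R by rewrite ler_peMl // lerDl ltW.
lra.
Qed.

Lemma chromatic_gt2 : (2 < chromatic_number F)%N.
Proof.
rewrite /chromatic_number; case: ex_minnP => k /existsP[c /forallP cP] _.
rewrite ltnNge; apply: contraNN nonbipF => k2.
apply/existsP; exists [set x | c x == 0%N :> nat]; apply/forallP => x; apply/forallP => y.
apply/implyP => Fxy; have /forallP/(_ y)/implyP/(_ Fxy) := cP x.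
rewrite !inE -val_eqE /=; have := leq_trans (ltn_ord (c x)) k2.
have := leq_trans (ltn_ord (c y)) k2.
by case: (val (c x)) => [|[|]] //; case: (val (c y)) => [|[|]].
Qed.

Lemma multipartite_free n (G : sgraph 'I_n) : complete_multipartite r G -> is_free F G.
Proof.
case/existsP => c /forallP cP; apply/negP => /existsP[h /andP[_ /forallP hP]].
have : colorable F r.
  apply/existsP; exists [ffun w => c (h w)]; apply/forallP => x; apply/forallP => y.
  apply/implyP => Fxy; rewrite !ffunE; have /forallP/(_ (h y))/eqP <- := cP (h x).
  by have /forallP/(_ y)/implyP := hP x; apply.
move: chromatic_gt2; rewrite /chromatic_number; case: ex_minnP => k _ kmin k2 /kmin.
by case: k k2 {kmin} => // k _ /=; rewrite ltnn.
Qed.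

Lemma ex_f'_le_ex_f n : ex_f' f n F <= ex_f f n F.
Proof.
have [[G /multipartite_free Gfree eqG] _] := ef_maxP f (edgeless_multipartite 'I_n nonbipF).
have [_ /(_ G Gfree)] := ef_maxP f (edgeless_free 'I_n nonbipF).
by rewrite /ex_f' eqG.
Qed.

(** Vertex [m] of ['I_n] takes the colour of its residue modulo [s]; every
residue class has at least [n %/ s] elements. *)
Lemma blowup_le_ex_f' n s (c : 'I_s -> nat) : (0 < s)%N -> (forall i, c i < r)%N ->
  (n %/ s)%:R * (\sum_i f (n %/ s * #|[set j | c j != c i]|)) <= ex_f' f n F.
Proof.
move=> s0 cr; pose pi (m : 'I_n) : 'I_s := Ordinal (ltn_pmod m s0).
have fib i : (n %/ s <= #|[set m | pi m == i]|)%N by apply: card_residue.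
have mp : complete_multipartite r (multipartite (c \o pi)).
  apply/existsP; exists [ffun m => Ordinal (cr (pi m))].
  by apply/forallP => x; apply/forallP => y; rewrite /adj /= !ffunE.
have [_ /(_ _ mp)] := ef_maxP f (edgeless_multipartite 'I_n nonbipF).
apply: le_trans; rewrite /ef (partition_big pi predT) //= mulr_sumr.
apply: ler_sum => i _.
apply: (@le_trans _ _ (\sum_(m | pi m == i) f (n %/ s * #|[set j | c j != c i]|))).
  rewrite sumr_const -[leRHS]mulr_natl ler_wpM2r ?log_continuous_ge0 // ler_nat.
  by rewrite (leq_trans (fib i)) // cardsE.
apply: ler_sum => m /eqP pim; apply: f_nondecreasing.
rewrite /deg -[leqRHS]sum1_card (partition_big pi (fun j => c j != c i)) /=; last first.
  by move=> y; rewrite inE /adj /= ffunE /= pim eq_sym.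
rewrite mulnC -sum_nat_const; under eq_bigl => j do rewrite inE.
apply: leq_sum => j cji; rewrite (leq_trans (fib j)) // -sum1_card.
rewrite [leqLHS]big_mkcond [leqRHS]big_mkcond; apply: leq_sum => y _.
rewrite !inE /adj /= ffunE /= pim.
by case: eqP => // ->; rewrite eq_sym cji.
Qed.

(** A step of length [k = floor (d * n)] at most doubles [f], and about 4 / d
such steps lead from [n] beyond [2 * n]. *)
Lemma logcont_doubling : exists C : R, exists N : nat, 0 < C /\
  forall n, (N <= n)%N -> f (2 * n).+1 <= C * f n.
Proof.
have [d [d0 H]] := f_logcont ltr01.
have [J HJ] := nat_above (4 / d).
have [N HN] := nat_above (2 / d).
exists (2 ^+ J), N.+1; split=> [|n Nn]; first exact: exprn_gt0.
have n1 : 1 <= n%:R :> R by rewrite ler1n (leq_trans _ Nn).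
pose k := Num.truncn (d * n%:R).
have dn : 2 <= d * n%:R.
  rewrite -ler_pdivrMl // mulrC (le_trans HN) // ler_nat; exact: ltnW.
have kd : k%:R <= d * n%:R by rewrite truncn_le; lra.
have dk : d * n%:R < k%:R + 1 by rewrite natr1 truncnS_gt.
have step j : f (n + j * k)%N <= 2 ^+ j * f n.
  elim: j => [|j IH]; first by rewrite addn0 expr0 mul1r.
  apply: (@le_trans _ _ ((1 + 1) * f (n + j * k)%N)).
    apply: H; first by rewrite leq_add2l leq_mul2r leqnSn orbT.
    rewrite mulSn !natrD natrM; have : 0 <= d * (j%:R * k%:R) by rewrite !mulr_ge0 // ltW.
    lra.
  by rewrite exprS -mulrA ler_pM2l.
apply: le_trans (step J); apply: f_nondecreasing.
rewrite mul2n -addnn -addnS leq_add2l -(ler_nat R) natrM -natr1.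
have : 4 * n%:R <= J%:R * (d * n%:R) by rewrite mulrA ler_pM2r -?ler_pdivrMr //; lra.
have : J%:R * (d * n%:R) <= J%:R * (k%:R * 2) by rewrite ler_wpM2l //; lra.
lra.
Qed.

Lemma two_parts_le_ex_f' n : (n %/ 2)%:R * (2 * f (n %/ 2)) <= ex_f' f n F.
Proof.
have := @blowup_le_ex_f' n 2 (fun i => i) isT.
have -> : \sum_(i < 2) f (n %/ 2 * #|[set j : 'I_2 | j != i :> nat]|) = 2 * f (n %/ 2)%N.
  rewrite (eq_bigr (fun=> f (n %/ 2)%N)) => [|i _].
    by rewrite sumr_const card_ord mulr_natl.
  have -> : [set j : 'I_2 | j != i :> nat] = [set~ i] by apply/setP => j; rewrite !inE.
  by rewrite cardsC1 card_ord muln1.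
apply=> i; apply: (leq_trans (ltn_ord i)).
by have := chromatic_gt2; case: (chromatic_number F).
Qed.

(** A bounded multiple of [ex_f'] exceeds the trivial upper bound [n * f n] on
any degree sum, so an error that is a small multiple of the latter is a
relative error. *)
Lemma top_degree_le_ex_f' : exists C : R, exists N : nat, 0 < C /\
  forall n, (N <= n)%N -> n%:R * f n <= C * ex_f' f n F.
Proof.
have [C [N [C0 HN]]] := logcont_doubling.
exists (2 * C), (2 * N + 2)%N; split=> [|n Nn]; first by rewrite mulr_gt0.
set q := (n %/ 2)%N.
have nq : (n <= (2 * q).+1)%N.
  by rewrite {1}(divn_eq n 2) mulnC -[leqRHS]addn1 leq_add2l -ltnS ltn_pmod.
have q1 : (1 <= q)%N by rewrite /q divn_gt0 // (leq_trans _ Nn) // addn2.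
have Nq : (N <= q)%N by rewrite /q leq_divRL // mulnC (leq_trans _ Nn) // leq_addr.
have fq := log_continuous_ge0 q.
apply: (@le_trans _ _ ((4 * q%:R) * (C * f q))).
  apply: ler_pM; rewrite ?log_continuous_ge0 //; last first.
    by apply: le_trans (HN _ Nq); apply: f_nondecreasing.
  have : n%:R <= (2 * q).+1%:R :> R by rewrite ler_nat.
  have : 1 <= q%:R :> R by rewrite ler1n.
  by rewrite -natr1 natrM; lra.
have := two_parts_le_ex_f' n; rewrite -/q -(ler_pM2l C0); lra.
Qed.

(** * Averaging over samples *)

(** [gam] is the tolerance on sampled degrees and [kap] the error rate, with
[n] large compared with [s]. *)
Section Sampling.
Variables (n s : nat) (e1 delta gam kap : R).
Hypotheses (s0 : (0 < s)%N) (n4 : (4 <= n)%N)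
  (e10 : 0 < e1) (d0 : 0 < delta) (g0 : 0 < gam) (k0 : 0 < kap)
  (k8 : kap <= 8^-1) (g8 : gam <= 8^-1) (gdk : gam <= delta * kap / 4)
  (sdk : s%:R <= delta * kap / 4 * n%:R)
  (qs : 1 <= e1 * (n %/ s)%:R) (q2 : 1 <= e1 * (n %/ 2)%:R)
  (logc : forall m n : nat, (n <= m)%N -> m%:R <= (1 + delta) * n%:R ->
    f m <= (1 + e1) * f n).

(** [c] is a colouring that dominates the sampled graph and [D i] the degree of
the [i]-th sampled vertex in the whole graph. If all degrees [dH i] in the
complete multipartite graph of [c] are at least [kap * s], the additive error
in [D i] is a relative error after blowing up, and log-continuity applies.
Otherwise some colour class has almost all the points: there [D i] is at most
[n / 4], so that a balanced bipartite graph does better, and the few other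
points are charged [f n] each. *)
Lemma sampled_sum_le (D c : 'I_s -> nat) (good : pred 'I_s) :
  (forall i, c i < r)%N -> (forall i, D i <= n)%N ->
  (forall i, good i ->
     s%:R * ((D i)%:R / n%:R) <= #|[set j | c j != c i]|%:R + gam * s%:R) ->
  \sum_(i | good i) f (D i) <=
    s%:R / n%:R * ((1 + e1) ^+ 2 * ex_f' f n F) + kap * s%:R * f n.
Proof.
move=> cr Dn Dgood.
(* lra reads the local hypotheses only, not those of the section. *)
have [e1pos dpos gpos kpos] := And4 e10 d0 g0 k0.
have [kle gle gdkle sle] := And4 k8 g8 gdk sdk.
pose dH (i : 'I_s) := #|[set j | c j != c i]|.
have f0 := log_continuous_ge0.
have nR : 4 <= n%:R :> R by rewrite ler_nat.
have n0 : 0 < n%:R :> R by lra.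
have sR : 0 < s%:R :> R by rewrite ltr0n.
have sn0 : 0 < s%:R / n%:R :> R by rewrite divr_gt0.
set M := ex_f' f n F.
have Mtwo : f (n %/ 2) <= n%:R^-1 * ((1 + e1) * M).
  have h : 0 <= 2 * f (n %/ 2) by rewrite mulr_ge0.
  have := mean_le_of_blowup n0 h (ler0n _ 2) (two_parts_le_ex_f' n)
    (@divn_ratio _ n 2 _ isT q2) (ltW e10).
  rewrite -/M; lra.
have M0 : 0 <= M.
  have : 0 <= n%:R^-1 * ((1 + e1) * M) by apply: le_trans Mtwo.
  rewrite pmulr_rge0 ?invr_gt0 // pmulr_rge0 //; lra.
have ss : (1 + e1) * M <= (1 + e1) ^+ 2 * M.
  by rewrite ler_wpM2r // expr2 ler_peMl //; lra.
have Dle i : good i -> (D i)%:R <= n%:R / s%:R * (dH i)%:R + gam * n%:R.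
  move=> gi; have := Dgood _ gi; rewrite -/(dH i) => H.
  have : n%:R / s%:R * (s%:R * ((D i)%:R / n%:R)) <= n%:R / s%:R * ((dH i)%:R + gam * s%:R).
    by rewrite ler_pM2l // divr_gt0.
  have -> : n%:R / s%:R * (s%:R * ((D i)%:R / n%:R)) = (D i)%:R :> R.
    by field; rewrite !gt_eqF.
  have -> : n%:R / s%:R * ((dH i)%:R + gam * s%:R) = n%:R / s%:R * (dH i)%:R + gam * n%:R.
    by field; rewrite gt_eqF.
  by [].
case: (pselect (exists i0, (dH i0)%:R < kap * s%:R)) => [[i0 small]|large].
  rewrite (bigID (fun i => c i == c i0)) /=; apply: lerD; last first.
    apply: (@le_trans _ _ (\sum_(i | c i != c i0) f n)).
      rewrite [leLHS]big_mkcond [leRHS]big_mkcond; apply: ler_sum => i _.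
      by case: (good i) => /=; case: eqP => //= _; apply: f_nondecreasing.
    rewrite sumr_const -[leLHS]mulr_natl ler_wpM2r // ltW //.
    by move: small; rewrite /dH cardsE.
  apply: (@le_trans _ _ (\sum_(i < s) f (n %/ 2))).
    rewrite [leLHS]big_mkcond; apply: ler_sum => i _.
    case: ifP => // /andP[gi /eqP ci]; apply: f_nondecreasing.
    have ltn : (D i)%:R <= n%:R / 4 :> R.
      apply: le_trans (Dle _ gi) _.
      have -> : dH i = dH i0 by rewrite /dH ci.
      have : n%:R / s%:R * (dH i0)%:R <= n%:R / s%:R * (kap * s%:R).
        by rewrite ler_wpM2l // ?ltW // divr_gt0.
      have -> : n%:R / s%:R * (kap * s%:R) = kap * n%:R by field; rewrite gt_eqF.
      have : kap * n%:R <= 8^-1 * n%:R by rewrite ler_pM2r.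
      have : gam * n%:R <= 8^-1 * n%:R by rewrite ler_pM2r.
      lra.
    rewrite leq_divRL // -(ler_nat R) natrM; lra.
  rewrite sumr_const card_ord -[leLHS]mulr_natl.
  apply: (@le_trans _ _ (s%:R * (n%:R^-1 * ((1 + e1) * M)))); first by rewrite ler_pM2l.
  by rewrite mulrA ler_pM2l.
have dHlarge i : kap * s%:R <= (dH i)%:R.
  by rewrite leNgt; apply/negP => ?; apply: large; exists i.
set q := (n %/ s)%N.
have nq : n%:R <= q%:R * s%:R + s%:R :> R.
  by rewrite -natrM -natrD addnC -mulSn ler_nat ltnW // ltn_ceil.
have q1 : 1 <= q%:R :> R.
  rewrite ler1n lt0n; apply/eqP => q0; move: qs; rewrite -/q q0 mulr0; lra.
have ns : n%:R / s%:R <= q%:R + 1 :> R by rewrite ler_pdivrMr //; lra.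
apply: (@le_trans _ _ ((1 + e1) * \sum_i f (q * dH i))).
  rewrite mulr_sumr [leLHS]big_mkcond; apply: ler_sum => i _.
  case: ifP => [gi|_]; last by rewrite mulr_ge0 //; lra.
  apply: (@le_trans _ _ (f (maxn (D i) (q * dH i)))); first by apply/f_nondecreasing/leq_maxl.
  apply: logc; first exact: leq_maxr.
  rewrite /maxn; case: ifP => _; first by rewrite ler_peMl //; lra.
  apply: le_trans (Dle _ gi) _; rewrite natrM.
  have h1 : n%:R / s%:R * (dH i)%:R <= (q%:R + 1) * (dH i)%:R :> R by rewrite ler_wpM2r.
  have h2 : (dH i)%:R <= s%:R :> R by rewrite ler_nat -[leqRHS]card_ord max_card.
  have h3 : q%:R * (kap * s%:R) <= q%:R * (dH i)%:R by rewrite ler_wpM2l.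
  have h4 : n%:R <= 2 * (q%:R * s%:R) :> R.
    have : s%:R <= q%:R * s%:R :> R by rewrite ler_peMl.
    lra.
  have h5 : gam * n%:R <= delta * kap / 4 * n%:R by rewrite ler_wpM2r.
  have h6 : delta * kap / 4 * n%:R <= delta * kap / 4 * (2 * (q%:R * s%:R)).
    by rewrite ler_wpM2l // ?divr_ge0 ?mulr_ge0 // ltW.
  have h7 : delta * (q%:R * (kap * s%:R)) <= delta * (q%:R * (dH i)%:R).
    by rewrite ler_pM2l.
  lra.
have S0 : 0 <= \sum_i f (q * dH i)%N by apply: sumr_ge0.
have := mean_le_of_blowup n0 S0 (ltW sR) (@blowup_le_ex_f' n s c s0 cr)
    (divn_ratio s0 qs) (ltW e10).
rewrite -/M => SM.
apply: (@le_trans _ _ ((1 + e1) * (s%:R / n%:R * ((1 + e1) * M)))).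
  by rewrite ler_pM2l //; lra.
rewrite -[leLHS]addr0 lerD //; last by rewrite !mulr_ge0 // ltW.
by rewrite expr2; lra.
Qed.

(** The three error terms charge [f n] to: the exceptional points of
[sampled_sum_le], the points whose sampled degree is too low, and all the
points of a sample that contains a clique of size [r + 1]. *)
Lemma sample_sum_bound (G : sgraph 'I_n) (x : {ffun 'I_s -> 'I_n}) :
  \sum_i f (deg G (x i)) <=
    s%:R / n%:R * ((1 + e1) ^+ 2 * ex_f' f n F) + (kap * s%:R
    + \sum_i (\sum_j (adj G (x i) (x j))%:R + gam * s%:R
                < s%:R * ((\sum_w (adj G (x i) w)%:R) / n%:R))%R%:R
    + s%:R * [exists u : r.+1.-tuple 'I_s, pairwise (relpre x (adj G)) u]%:R) * f n.
Proof.
have f0 := log_continuous_ge0.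
set bad := fun i => (\sum_j (adj G (x i) (x j))%:R + gam * s%:R
                < s%:R * ((\sum_w (adj G (x i) w)%:R) / n%:R))%R.
have Dn i : (deg G (x i) <= n)%N by rewrite -[leqRHS]card_ord max_card.
have M0 : 0 <= ex_f' f n F.
  have [[H _ eqH] _] := ef_maxP f (edgeless_multipartite 'I_n nonbipF).
  by rewrite /ex_f' eqH; apply: sumr_ge0.
have B0 : 0 <= s%:R / n%:R * ((1 + e1) ^+ 2 * ex_f' f n F).
  by rewrite !mulr_ge0 ?invr_ge0 ?addr_ge0 ?(ltW e10).
have bad0 : 0 <= \sum_i (bad i)%:R :> R by apply: sumr_ge0.
have ks0 : 0 <= kap * s%:R by rewrite mulr_ge0 // ltW.
case: existsP => [_|noclique].
  rewrite mulr1; apply: (@le_trans _ _ (s%:R * f n)).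
    rewrite mulr_natl -[X in _ *+ X]card_ord -sumr_const.
    by apply: ler_sum => i _; apply: f_nondecreasing.
  have : 0 <= (kap * s%:R + \sum_i (bad i)%:R) * f n by rewrite mulr_ge0 // addr_ge0.
  lra.
have [||c cP] := @clique_free_dominated _ (relpre x (adj G)) r [set: 'I_s].
- by move=> i j; rewrite /= adj_sym.
- move=> u su _; apply/negP => pu; apply: noclique.
  by exists (tcast su (in_tuple u)); rewrite val_tcast.
rewrite (bigID (predC bad)) /= mulr0 addr0 mulrDl addrA; apply: lerD.
  apply: (@sampled_sum_le (fun i => deg G (x i)) c) => //.
    by move=> i; have [] := cP i (finset.in_setT i).
  move=> i; rewrite /bad -leNgt /deg (natr_card R (adj G (x i))) => /le_trans; apply.
  rewrite lerD2r.
  have [_] := cP i (finset.in_setT i); rewrite -(ler_nat R) => H.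
  apply: (@le_trans _ _ #|[set y in [set: 'I_s] | relpre x (adj G) i y]|%:R).
    rewrite (natr_card R [pred y in [set: 'I_s] | relpre x (adj G) i y]) /=.
    by apply: ler_sum => j _; rewrite finset.in_setT.
  apply: le_trans H _; rewrite ler_nat.
  by apply/subset_leq_card/fintype.subsetP => j; rewrite !inE.
rewrite mulr_suml big_mkcond; apply: ler_sum => i _; rewrite negbK.
rewrite -/(bad i); case: (bad i) => /=; rewrite ?mul1r ?mul0r //.
exact: f_nondecreasing.
Qed.

(** Average [sample_sum_bound] over all samples; each of its three error terms is
at most [kap * s * f n] in the mean. The hypothesis on [gam ^+ 2 * s] is the
one that Chebyshev's inequality asks for. *)
Lemma ef_le_of_few_cliques (G : sgraph 'I_n) :
  (gam ^+ 2 * s%:R)^-1 <= kap ->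
  \sum_(u : r.+1.-tuple 'I_n) (pairwise (adj G) u)%:R
    <= kap / s%:R ^+ r.+1 * n%:R ^+ r.+1 ->
  ef f G <= (1 + e1) ^+ 2 * ex_f' f n F + 3 * kap * (n%:R * f n).
Proof.
move=> Hs few.
set k := r.+1 in few *; set M := ex_f' f n F.
have n0 : 0 < n%:R :> R by rewrite ltr0n (leq_trans _ n4).
have sR : 0 < s%:R :> R by rewrite ltr0n.
have V0 : (0 < #|'I_n|)%N by rewrite card_ord (leq_trans _ n4).
have I0 : (0 < #|'I_s|)%N by rewrite card_ord.
pose T := n%:R ^+ s : R.
have T0 : 0 < T by rewrite exprn_gt0.
have cliques : \sum_(x : {ffun 'I_s -> 'I_n})
    [exists u : k.-tuple 'I_s, pairwise (relpre x (adj G)) u]%:R <= kap * T.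
  have := @sampled_cliques R 'I_s _ G k (kap / s%:R ^+ k) V0.
  rewrite !card_ord -/T => /(_ few)/le_trans; apply.
  by rewrite mulrCA mulfV ?mulr1 // expf_neq0 ?gt_eqF.
pose bad (x : {ffun 'I_s -> 'I_n}) i := (\sum_j (adj G (x i) (x j))%:R + gam * s%:R
                < s%:R * ((\sum_w (adj G (x i) w)%:R) / n%:R))%R.
have bads i : \sum_x (bad x i)%:R <= kap * T.
  have := @sample_degree_deviates R _ _ (adj G) V0 I0 i gam g0.
  rewrite !card_ord -/T => /le_trans; apply.
  by rewrite mulrC ler_pM2r.
have const (a : R) : \sum_(x : {ffun 'I_s -> 'I_n}) a = T * a.
  by rewrite sumr_const card_ffun !card_ord -[LHS]mulr_natl natrX.
have total : s%:R * (T * ef f G) <= n%:R * (T * (s%:R / n%:R * ((1 + e1) ^+ 2 * M)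
      + 3 * (kap * s%:R) * f n)).
  have -> : s%:R * (T * ef f G) = n%:R * \sum_(x : {ffun 'I_s -> 'I_n}) \sum_i f (deg G (x i)).
    rewrite [in RHS]exchange_big /= [RHS]mulr_sumr (eq_bigr (fun=> T * ef f G)) => [|i _].
      by rewrite sumr_const card_ord mulr_natl.
    by have := sum_sample1 i (fun v : 'I_n => f (deg G v)); rewrite !card_ord.
  rewrite ler_pM2l //.
  apply: (@le_trans _ _ (\sum_(x : {ffun 'I_s -> 'I_n})
    (s%:R / n%:R * ((1 + e1) ^+ 2 * M) + (kap * s%:R + \sum_i (bad x i)%:R
      + s%:R * [exists u : k.-tuple 'I_s, pairwise (relpre x (adj G)) u]%:R) * f n))).
    apply: ler_sum => x _.
    exact: sample_sum_bound.
  rewrite big_split /= const mulrDr lerD2l -mulr_suml !big_split /= const -mulr_sumr.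
  rewrite exchange_big /= [leRHS]mulrA ler_wpM2r ?log_continuous_ge0 //.
  have h1 : \sum_(i < s) \sum_x (bad x i)%:R <= s%:R * (kap * T).
    rewrite mulr_natl -[X in _ *+ X](card_ord s) -sumr_const.
    by apply: ler_sum => i _; apply: bads.
  have h2 := ler_wpM2l (ltW sR) cliques.
  have -> : T * (3 * (kap * s%:R)) = T * (kap * s%:R) + s%:R * (kap * T) + s%:R * (kap * T).
    by ring.
  by rewrite lerD // lerD.
rewrite -(ler_pM2l (mulr_gt0 sR T0)) -mulrA (le_trans total) //.
rewrite le_eqVlt; apply/orP; left; apply/eqP; field; exact: lt0r_neq0.
Qed.

End Sampling.

(** The constants are chosen in the order [e1] and [kap] from [eps], [delta] from
[e1], [gam] from [delta] and [kap], [s] from [gam] and [kap], and [n] last: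
the clique density [kap / s ^+ r.+1] that [n] must enforce depends on the
sample size. *)
Lemma ex_f_upper (eps : R) : 0 < eps ->
  exists N, forall n, (N <= n)%N -> ex_f f n F <= (1 + eps) * ex_f' f n F.
Proof.
move=> eps0; have [C [N0 [C0 top]]] := top_degree_le_ex_f'.
have [e1 [e10 e11 e18]] : exists e1 : R, [/\ 0 < e1, e1 <= 1 & e1 <= eps / 8].
  exists (Num.min 1 (eps / 8)); split; rewrite ?ge_min ?lexx ?orbT //.
  by rewrite lt_min ltr01 /=; lra.
have [kap [k0 k8 kC]] : exists kap : R, [/\ 0 < kap, kap <= 8^-1 & kap <= eps / (6 * C)].
  exists (Num.min 8^-1 (eps / (6 * C))); split; rewrite ?ge_min ?lexx ?orbT //.
  by rewrite lt_min invr_gt0 divr_gt0 ?mulr_gt0 // ltr0n.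
have [delta [d0 logc]] := f_logcont e10.
have dk0 : 0 < delta * kap / 4 by rewrite divr_gt0 ?mulr_gt0 // ltr0n.
have [gam [g0 g8 gdk]] : exists gam : R, [/\ 0 < gam, gam <= 8^-1 & gam <= delta * kap / 4].
  exists (Num.min 8^-1 (delta * kap / 4)); split; rewrite ?ge_min ?lexx ?orbT //.
  by rewrite lt_min dk0 invr_gt0 ltr0n.
have [s [s0 Hs]] : exists s : nat, (0 < s)%N /\ (gam ^+ 2 * s%:R)^-1 <= kap.
  have [s Hs] := nat_above (gam ^+ 2 * kap)^-1; exists s.+1; split=> //.
  have g2 : 0 < gam ^+ 2 by rewrite exprn_gt0.
  rewrite -[leRHS]invrK lef_pV2 ?posrE ?invr_gt0 ?mulr_gt0 ?ltr0n //.
  rewrite -ler_pdivrMl // -invfM (le_trans Hs) // ler_nat; exact: leqnSn.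
have sR : 0 < s%:R :> R by rewrite ltr0n.
have colF : colorable F r.+1.
  have := chromatic_gt2; rewrite /chromatic_number; case: ex_minnP => m colm _.
  by case: m colm.
have mu0 : 0 < kap / s%:R ^+ r.+1 by rewrite divr_gt0 // exprn_gt0.
have [N1 HN1] := few_cliques colF mu0.
have [E HE] := nat_above e1^-1.
have [L HL] := nat_above (s%:R / (delta * kap / 4)).
exists (maxn (maxn (maxn N0 N1) (maxn 4 L)) (maxn (E * s) (E * 2))) => n.
rewrite !geq_max => /andP[/andP[/andP[nN0 nN1] /andP[n4 nL]] /andP[nEs nE2]].
have ratio t : (0 < t)%N -> (E * t <= n)%N -> 1 <= e1 * (n %/ t)%:R.
  move=> t0 nt; rewrite -ler_pdivrMl // mulr1 (le_trans HE) // ler_nat.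
  by rewrite leq_divRL.
have sdk : s%:R <= delta * kap / 4 * n%:R.
  by rewrite mulrC -ler_pdivrMr // (le_trans HL) // ler_nat.
have [[G Gfree eqG] _] := ef_maxP f (edgeless_free 'I_n nonbipF).
have := HN1 'I_n G; rewrite card_ord => /(_ nN1 Gfree) few.
have qs := ratio s s0 nEs; have q2 := ratio 2 isT nE2.
have efG := ef_le_of_few_cliques s0 n4 e10 d0 g0 k0 k8 g8 gdk sdk qs q2 logc Hs few.
rewrite /ex_f eqG; apply: le_trans efG _.
have := top _ nN0; have := log_continuous_ge0 n.
move: (ex_f' f n F) (f n) => M fn fn0 topM.
have M0 : 0 <= M by rewrite -(pmulr_rge0 _ C0) (le_trans _ topM) // mulr_ge0.
exact: collect_errors topM.
Qed.
End Degrees.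

Local Open Scope classical_set_scope.

Theorem theorem2 (R : realType) (W : finType) (F : sgraph W) (f : nat -> R)
  (nonbipF : ~~ bipartite F)
  (f_nondecreasing : {homo f : m n / (m <= n)%N >-> m <= n})
  (f_logcont : log_continuous f) :
  exists eta : nat -> R,
    eta @ \oo --> (0 : R) /\
    \forall n \near \oo, ex_f f n F = (1 + eta n) * ex_f' f n F.
Proof.
(* Where ex_f' vanishes, so does ex_f once n is large: any default would give
   the equation, and 0 gives the limit. *)
pose eta n : R := if ex_f' f n F == 0 then 0 else ex_f f n F / ex_f' f n F - 1.
have lower := ex_f'_le_ex_f f nonbipF.
have ge0 n : 0 <= ex_f' f n F.
  have [[H _ eqH] _] := ef_maxP f (edgeless_multipartite 'I_n nonbipF).
  by rewrite /ex_f' eqH; apply: sumr_ge0 => i _; apply: log_continuous_ge0.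
have upper := ex_f_upper nonbipF f_nondecreasing f_logcont.
exists eta; split.
  apply/cvgrPdist_le => eps eps0; have [N HN] := upper _ eps0.
  exists N => // n /= Nn; rewrite sub0r normrN /eta.
  case: eqP => [_|/eqP ne]; first by rewrite normr0 ltW.
  have pos : 0 < ex_f' f n F by rewrite lt_neqAle eq_sym ne ge0.
  rewrite ger0_norm; first by rewrite lerBlDr addrC ler_pdivrMr // HN.
  by rewrite subr_ge0 ler_pdivlMr // mul1r lower.
have [N HN] := upper _ ltr01.
exists N => // n /= Nn; rewrite /eta; case: eqP => [z|/eqP ne].
  by apply/eqP; rewrite eq_le addr0 mul1r lower andbT (le_trans (HN _ Nn)) // z mulr0.
by rewrite addrC subrK divfK.
Qed.
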